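(* Let $1\le k\le n-1$. Both $\Delta^{NN}_{k,n}$ and $\Delta^{NC}_{k,n}$ are flag unimodular triangulations of $\mathcal{O}_{k,n}$ (via the identification of $I\in V_{k,n}$ with the vertex $\chi_I$).
   Context: $V_{k,n}$ denotes the set of integer vectors $I=(i_1,\dots,i_k)$ with $1\le i_1<\dots<i_k\le n$. Two arcs $(p<p')$, $(q<q')$ cross if $p<q<p'<q'$ or $q<p<q'<p'$; they nest if $p<q<q'<p'$ or $q<p<p'<q'$. $I,J\in V_{k,n}$ are noncrossing if for all $1\le a<b\le k$ with $i_\ell=j_\ell$ for all $a<\ell<b$, the arcs $(i_a<i_b)$ and $(j_a<j_b)$ do not cross; they are nonnesting if for all $1\le a<b\le k$ these arcs do not nest. $\Delta^{NC}_{k,n}$ (resp. $\Delta^{NN}_{k,n}$) is the flag simplicial complex on $V_{k,n}$ whose faces are the sets of pairwise noncrossing (resp. nonnesting) vectors. Let $P_{k,n}=\{(a,b):a\in[k],b\in[n-k]\}$ and $\chi_I\in\{0,1\}^{P_{k,n}}$ with $(\chi_I)_{a,b}=1$ iff $i_a\le a+b-1$. The order polytope is $\mathcal{O}_{k,n}=\{x\in[0,1]^{P_{k,n}}: x_{a,b}\le x_{a,b+1},\ x_{a+1,b}\le x_{a,b}\}$, whose vertices are exactly the $\chi_I$. A simplicial complex on $V_{k,n}$ triangulates $\mathcal{O}_{k,n}$ if the sets $\{\chi_I:I\in\sigma\}$ are affinely independent and the simplices $\mathrm{conv}\{\chi_I:I\in\sigma\}$ cover $\mathcal{O}_{k,n}$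 and meet in common faces; unimodular means each maximal simplex is a lattice basis simplex of $\mathbb{Z}^{P_{k,n}}$ (volume $1/(k(n-k))!$). *)

(* Defs.v *)
From HB Require Import structures.
From mathcomp Require Import all_boot all_order all_algebra.
Set Implicit Arguments. Unset Strict Implicit. Unset Printing Implicit Defensive.
Import Order.TTheory GRing.Theory Num.Theory.
Local Open Scope ring_scope.

(* A vector I = (i_1,...,i_k) is represented by the sequence [:: i_1; ...; i_k]
   of naturals (1-indexed entries, values in [1,n]). *)
Definition inV (k n : nat) (I : seq nat) : bool :=
  [&& size I == k, sorted ltn I & all (fun i => (0 < i <= n)%N) I].

Definition ent (I : seq nat) (a : nat) : nat := nth 0%N I a.-1.

(* arcs (p<p') and (q<q') cross / nest *)
Definition cross (p p' q q' : nat) : bool :=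
  [&& p < q, q < p' & p' < q']%N || [&& q < p, p < q' & q' < p']%N.
Definition nest (p p' q q' : nat) : bool :=
  [&& p < q, q < q' & q' < p']%N || [&& q < p, p < p' & p' < q']%N.

Definition noncrossing (k : nat) (I J : seq nat) : Prop :=
  forall a b : nat, (1 <= a)%N -> (a < b)%N -> (b <= k)%N ->
    (forall l, (a < l)%N -> (l < b)%N -> ent I l = ent J l) ->
    ~~ cross (ent I a) (ent I b) (ent J a) (ent J b).

Definition nonnesting (k : nat) (I J : seq nat) : Prop :=
  forall a b : nat, (1 <= a)%N -> (a < b)%N -> (b <= k)%N ->
    ~~ nest (ent I a) (ent I b) (ent J a) (ent J b).

Definition flag_face (compat : seq nat -> seq nat -> Prop) (k n : nat)
  (s : seq (seq nat)) : Prop :=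
  [/\ uniq s, (forall I, I \in s -> inV k n I) &
      (forall I J, I \in s -> J \in s -> compat I J)].

Definition DeltaNC (k n : nat) := flag_face (noncrossing k) k n.
Definition DeltaNN (k n : nat) := flag_face (nonnesting k) k n.

(* Points of R^{P_{k,n}} are k x (n-k) matrices; entry (i,j) (0-indexed)
   is the coordinate (a,b) = (i+1, j+1). *)
Definition chi (R : pzRingType) (k n : nat) (I : seq nat) : 'M[R]_(k, n - k) :=
  \matrix_(i < k, j < n - k) ((ent I i.+1 <= i + j + 1)%N)%:R.
(* i.e. (chi_I)_{a,b} = 1 iff i_a <= a + b - 1 *)

Definition in_order_polytope (R : realFieldType) (k n : nat)
  (x : 'M[R]_(k, n - k)) : Prop :=
  [/\ (forall i j, 0 <= x i j <= 1),
      (forall (i : 'I_k) (j j' : 'I_(n - k)), val j' = (val j).+1 -> x i j <= x i j') &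
      (forall (i i' : 'I_k) (j : 'I_(n - k)), val i' = (val i).+1 -> x i' j <= x i j)].

Definition in_conv (R : realFieldType) (k n : nat) (s : seq (seq nat))
  (x : 'M[R]_(k, n - k)) : Prop :=
  exists lam : seq nat -> R,
    [/\ (forall I, I \in s -> 0 <= lam I),
        \sum_(I <- s) lam I = 1 &
        x = \sum_(I <- s) lam I *: chi R k n I].

Definition aff_indep (R : realFieldType) (k n : nat) (s : seq (seq nat)) : Prop :=
  forall c : seq nat -> R,
    \sum_(I <- s) c I = 0 -> \sum_(I <- s) c I *: chi R k n I = 0 ->
    forall I, I \in s -> c I = 0.

Definition triangulates (R : realFieldType) (k n : nat)
  (face : seq (seq nat) -> Prop) : Prop :=
  [/\ (forall s, face s -> @aff_indep R k n s),
      (forall x : 'M[R]_(k, n - k), in_order_polytope x -> exists s, face s /\ @in_conv R k n s x) &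
      (forall s t x, face s -> face t -> @in_conv R k n s x -> @in_conv R k n t x ->
         @in_conv R k n [seq I <- s | I \in t] x)].

Definition maximal_face (face : seq (seq nat) -> Prop) (s : seq (seq nat)) : Prop :=
  face s /\ (forall t, face t -> {subset s <= t} -> {subset t <= s}).

(* Unimodular: for each maximal simplex, the edge vectors chi_I - chi_I0 span
   the lattice Z^{P_{k,n}} over Z (affine independence is part of [triangulates]),
   i.e. it is a lattice basis simplex. *)
Definition unimodular (k n : nat) (face : seq (seq nat) -> Prop) : Prop :=
  forall s, maximal_face face s -> forall I0, I0 \in s ->
    forall z : 'M[int]_(k, n - k),
      exists c : seq nat -> int,
        z = \sum_(I <- s) c I *: (chi int k n I - chi int k n I0).

(* Main.v *)
Require Import Defs.
From HB Require Import structures.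
From mathcomp Require Import all_boot all_order all_algebra.
From mathcomp Require Import zify.
Set Implicit Arguments. Unset Strict Implicit. Unset Printing Implicit Defensive.
Import Order.TTheory GRing.Theory Num.Theory.
Local Open Scope ring_scope.

(* Record the vertex [chi_I] by the values [i_1, ..., i_k]: a nonnegative combination of
   vertices is determined, as a point, by the mass it gives to each value in each row.
   Both compatibility relations forbid the same pattern, for two opposite total orders (reverse
   lexicographic) on prefixes: I and J have prefixes P > Q before position b and continue
   them by v < w, although Q could also be continued by v.
   Exchanging the tails of such a pair keeps the marginals, and doing this cell by cell turns
   any combination into a compatible one.  A compatible combination is the greedy one, so it is
   determined by its marginals; uniqueness gives affine independence and the intersection
   property, existence gives the covering.  Both hold for coefficients in any totally ordered
   abelian group; over Z x Z with the lexicographic order they show that every vertex is an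
   integral combination of any maximal face, hence unimodularity. *)

(** * Increasing vectors *)

Section Vectors.
Variables k n : nat.

(* A row of arbitrary entries in [0, n]; [inc] selects those of V_{k,n}. *)
Definition vec := {ffun 'I_k -> 'I_n.+1}.

(** Positions are 0-indexed. The default 0 beyond [k] is also that of [nth 0], so [nth_seqv] needs
    no bound. *)
Definition co (I : vec) (l : nat) : nat :=
  if insub l is Some i then val (I i) else 0%N.

Definition mkvec (f : nat -> nat) : vec := [ffun i : 'I_k => inord (f i)].

Lemma co_ord (I : vec) (i : 'I_k) : co I i = I i.
Proof. by rewrite /co valK. Qed.

Lemma co_out (I : vec) l : (k <= l)%N -> co I l = 0%N.
Proof. by move=> kl; rewrite /co insubF // ltnNge kl. Qed.

Lemma co_mkvec f l : (l < k)%N -> (f l <= n)%N -> co (mkvec f) l = f l.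
Proof. by move=> lk fl; rewrite (co_ord _ (Ordinal lk)) ffunE inordK. Qed.

Lemma co_le I l : (co I l <= n)%N.
Proof. by rewrite /co; case: insub => // i; rewrite -ltnS ltn_ord. Qed.

Lemma co_inj (I J : vec) : (forall l, (l < k)%N -> co I l = co J l) -> I = J.
Proof. by move=> h; apply/ffunP => i; apply/val_inj; rewrite /= -!co_ord h. Qed.

Definition seqv (I : vec) : seq nat := mkseq (co I) k.

Lemma nth_seqv I l : nth 0%N (seqv I) l = co I l.
Proof.
case: (ltnP l k) => lk; first by rewrite nth_mkseq.
by rewrite nth_default ?size_mkseq // co_out.
Qed.

Lemma seqv_inj : injective seqv.
Proof. by move=> I J e; apply: co_inj => l _; rewrite -!nth_seqv e. Qed.

Definition inc (I : vec) : bool := inV k n (seqv I).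

Lemma inc_ltn I l m : inc I -> (l < m)%N -> (m < k)%N -> (co I l < co I m)%N.
Proof.
case/and3P => _ /(sorted_ltn_nth ltn_trans 0%N) h _ lm mk.
by have := h l m; rewrite !nth_seqv; apply; rewrite ?inE ?size_mkseq //;
  apply: ltn_trans mk.
Qed.

Lemma inc_gt I l : inc I -> (l < k)%N -> (l < co I l)%N.
Proof.
move=> vI; elim: l => [|l IH] lk.
  case/and3P: vI => _ _ /allP/(_ (co I 0)); rewrite -nth_seqv mem_nth ?size_mkseq //.
  by case/(_ isT)/andP.
by apply: leq_ltn_trans (inc_ltn vI (ltnSn l) lk); apply: IH; apply: ltnW.
Qed.

(** The [k - l.+1] later entries must still fit below [n]. Together with [inc_gt] this confines row
    [l] to the values from [l + 1] to [l + 1 + (n - k)], a range that the [n - k] thresholds of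
    [chi] separate completely. *)
Lemma inc_le I l : inc I -> (l < k)%N -> (co I l + (k - l.+1) <= n)%N.
Proof.
move=> vI lk; move: {-2}(k - l.+1)%N (leqnn (k - l.+1)) => m; elim: m => [|m IH] hm.
  by rewrite addn0 co_le.
have {IH}: (co I l + m <= co I (l + m))%N.
  elim: m {IH} hm => [|m IH] hm; first by rewrite !addn0.
  have := inc_ltn vI (ltnSn (l + m)); rewrite -addnS => /(_ ltac:(lia)).
  by have := IH ltac:(lia); lia.
have := inc_ltn vI (ltnSn (l + m)) ltac:(lia).
have := co_le I (l + m).+1; lia.
Qed.

Lemma inc_intro I : (forall l, (l < k)%N -> (0 < co I l)%N) ->
  (forall l, (l.+1 < k)%N -> (co I l < co I l.+1)%N) -> inc I.
Proof.
move=> h0 h1; apply/and3P; split; first by rewrite size_mkseq.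
  apply: (path_sorted (x := 0%N)); apply/(pathP 0%N) => -[|i].
    rewrite size_mkseq => /h0; rewrite /= nth_seqv //.
  by rewrite size_mkseq => /h1; rewrite /= !nth_seqv.
by apply/(all_nthP 0%N) => i; rewrite size_mkseq => /h0; rewrite nth_seqv co_le => ->.
Qed.

Lemma seqv_mkvec s : inV k n s -> seqv (mkvec (nth 0%N s)) = s.
Proof.
case/and3P => /eqP sz _ /(all_nthP 0%N) h.
apply: (eq_from_nth (x0 := 0%N)); rewrite size_mkseq // => i ik.
rewrite nth_seqv co_mkvec //; first by move: (h i); rewrite sz => /(_ ik) /andP[].
Qed.

(** Padding with zeros keeps prefixes of every length in the one finite type [vec], so that sums can
    be partitioned by prefix. *)
Definition trunc b (I : vec) : vec := mkvec (fun l => if (l < b)%N then co I l else 0%N).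

Lemma co_trunc b I l : co (trunc b I) l = if (l < b)%N then co I l else 0%N.
Proof.
case: (ltnP l k) => lk; last by rewrite !co_out //; case: ifP.
by rewrite co_mkvec //; case: ifP => // _; apply: co_le.
Qed.

Lemma truncP b I J : trunc b I = trunc b J <-> (forall l, (l < b)%N -> co I l = co J l).
Proof.
split=> [e l lb|h]; first by move: (co_trunc b J l); rewrite -e co_trunc lb.
by apply: co_inj => l _; rewrite !co_trunc; case: ifP => // /h.
Qed.

Definition splice b (J I : vec) : vec :=
  mkvec (fun l => if (l < b)%N then co J l else co I l).

Lemma co_splice b J I l : co (splice b J I) l = if (l < b)%N then co J l else co I l.
Proof.
case: (ltnP l k) => lk; last by rewrite !co_out //; case: ifP.
by rewrite co_mkvec //; case: ifP => // _; apply: co_le.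
Qed.

Lemma inc_splice b J I : inc J -> inc I -> (co J b.-1 < co I b)%N -> inc (splice b J I).
Proof.
move=> vJ vI h; apply: inc_intro => l lk; rewrite !co_splice.
  by case: ifP => _; [have := inc_gt vJ lk | have := inc_gt vI lk]; lia.
case: ifP => lb; case: ifP => lb1; try by apply: inc_ltn.
- by have [-> ->] : l = b.-1 /\ l.+1 = b by lia.
- by lia.
Qed.

End Vectors.

(** * Existence of compatible weights *)

(** A total order on the prefixes of each length, given by numbers; the bound [M] lets a rank serve
    as the last digit of a lexicographic code. *)
Record prefix_rank k n (M : nat) (r : nat -> vec k n -> nat) : Prop := PrefixRank {
  rank_lt : forall b I, (r b I < M)%N;
  rank_eq : forall b I J, r b I = r b J <-> trunc b I = trunc b J }.

(** The nonnegative elements of a totally ordered abelian group, as a bare predicate so that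
    [int * int] can carry the lexicographic order. *)
Record total_cone (G : zmodType) (pos : pred G) : Prop := TotalCone {
  coneD : forall x y, pos x -> pos y -> pos (x + y);
  cone_total : forall x, pos x || pos (- x);
  cone_anti : forall x, pos x -> pos (- x) -> x = 0 }.

Lemma cone0 (G : zmodType) (pos : pred G) : total_cone pos -> pos 0.
Proof. by move=> h; have := cone_total h 0; rewrite oppr0 orbb. Qed.

Lemma cone_sum (G : zmodType) (pos : pred G) (T : finType) (P : pred T) (F : T -> G) :
  total_cone pos -> (forall i, P i -> pos (F i)) -> pos (\sum_(i | P i) F i).
Proof.
by move=> h hF; elim/big_ind: _ => //; [apply: cone0 | apply: coneD].
Qed.

(** Otherwise the remaining terms would add up to a nonnegative element equal to [- F i], and
    antisymmetry would give [F i = 0]. *)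
Lemma cone_sum_eq0 (G : zmodType) (pos : pred G) (T : finType) (P : pred T)
    (F : T -> G) i :
  total_cone pos -> \sum_(j | P j) F j = 0 -> P i -> pos (F i) -> F i <> 0 ->
  exists2 j, P j & ~~ pos (F j).
Proof.
move=> h s0 Pi pi ni.
case: (boolP [exists j, P j && ~~ pos (F j)]) => [/existsP[j /andP[]]|nj]; first by exists j.
case: ni; apply: (cone_anti h) => //.
move: s0; rewrite (bigD1 i) //= => /eqP; rewrite addrC addr_eq0 => /eqP <-.
apply: (cone_sum h) => j /andP[Pj _]; apply: contraNT nj => nj.
by apply/existsP; exists j; rewrite Pj.
Qed.

Section Weights.
Variables (k n M : nat) (r : nat -> vec k n -> nat).
Hypothesis rP : prefix_rank M r.

(* [I] and [J] violate compatibility at [b] when the prefix of smaller rank, that of [J], could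
   be continued by the smaller value [co I b] but is not. *)
Definition viol b (I J : vec k n) : bool :=
  [&& r b J < r b I, co I b < co J b & co J b.-1 < co I b]%N.

Definition compat (I J : vec k n) : Prop := forall b, (b < k)%N -> ~~ viol b I J.

Variables (G : zmodType) (pos : pred G).
Hypothesis posP : total_cone pos.

Definition weight (w : vec k n -> G) : Prop :=
  (forall I, pos (w I)) /\ (forall I, w I != 0 -> inc I).

Definition compatible (w : vec k n -> G) : Prop :=
  forall I J, w I != 0 -> w J != 0 -> compat I J.

(** Arbitrary sets of values cover at once the total mass ([predT]), the thresholds of [chi] and
    single values. *)
Definition same_marginals (w w' : vec k n -> G) : Prop :=
  forall a (p : pred nat), (a < k)%N ->
    \sum_(I | p (co I a)) w I = \sum_(I | p (co I a)) w' I.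

Definition point_mass (K : vec k n) (m : G) (L : vec k n) : G := if L == K then m else 0.

Lemma sum_point_mass (P : pred (vec k n)) K m :
  \sum_(I | P I) point_mass K m I = if P K then m else 0.
Proof.
rewrite /point_mass big_mkcond (bigD1 K) //= eqxx big1 ?addr0 // => I.
by move/negPf->; case: ifP.
Qed.

Definition swap b (I J : vec k n) (m : G) (w : vec k n -> G) (L : vec k n) : G :=
  w L + point_mass (splice b J I) m L + point_mass (splice b I J) m L
  - point_mass I m L - point_mass J m L.

(** In every row the two spliced vectors show the same two values as [I] and [J], possibly
    exchanged. *)
Lemma swap_marginals b I J m w : same_marginals (swap b I J m w) w.
Proof.
move=> a p _; rewrite /swap !sumrB !big_split /= !sum_point_mass !co_splice.
rewrite -!addrA -[RHS]addr0; congr (_ + _).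
case: (a < b)%N; case: (p (co I a)); case: (p (co J a));
  by rewrite ?oppr0 ?addr0 ?add0r ?subrr // addrA -opprD subrr.
Qed.

Lemma viol_trunc b I J : viol b I J -> trunc b I != trunc b J.
Proof.
by case/and3P => h _ _; apply: contraTneq h => /(rank_eq rP) ->; rewrite ltnn.
Qed.

(* A code in [nat] for the lexicographic order on triples [(b, v, p)]. *)
Definition key b (v p : nat) : nat := ((b * n.+1 + v) * M + p)%N.

Lemma key_lt b v p b' v' p' : (v <= n)%N -> (v' <= n)%N -> (p < M)%N -> (p' < M)%N ->
  (key b v p < key b' v' p')%N =
  (b < b')%N || (b == b') && ((v < v')%N || (v == v') && (p < p')%N).
Proof.
have lexi x y x' y' m : (y < m)%N -> (y' < m)%N ->
    (x * m + y < x' * m + y')%N = (x < x')%N || (x == x') && (y < y')%N.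
  move=> ym ym'; case: (ltngtP x x') => [lx|lx|->] /=.
  - by apply/idP; have : (x.+1 * m <= x' * m)%N by [rewrite leq_mul2r lx orbT]; lia.
  - by apply/negbTE; have : (x'.+1 * m <= x * m)%N by [rewrite leq_mul2r lx orbT]; lia.
  - by rewrite ltn_add2l.
move=> hv hv' hp hp'; rewrite /key lexi // lexi //.
case: (ltngtP b b') => [lb|lb|->] //=; last by rewrite eqn_add2l.
rewrite [X in X && _](_ : _ = false) //; apply/negbTE/eqP => e.
have : (b'.+1 * n.+1 <= b * n.+1)%N by rewrite leq_mul2r lb orbT.
lia.
Qed.

(** The cell of a violation: its position, the smaller value, and the rank of the prefix that ought
    to be continued by that value. Cells are cleaned in increasing order of key. *)
Definition vkey b (I J : vec k n) := key b (co I b) (r b J).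

Definition clean (c : nat) (w : vec k n -> G) : Prop :=
  forall b I J, (b < k)%N -> w I != 0 -> w J != 0 -> viol b I J -> (c <= vkey b I J)%N.

(* For a violating pair, exchanging the tails removes [I] or [J] from this set and adds nothing. *)
Definition obstruction b v p (w : vec k n -> G) : {set vec k n} :=
  [set K | (w K != 0) && ((co K b == v) && (p < r b K)%N || (r b K == p) && (v < co K b)%N)].

(** As much mass as possible moves from [I] and [J] to the spliced [X] (prefix of [J], tail of [I])
    and [Y] (prefix of [I], tail of [J]). A violation of smaller key that involves [X] or [Y] would
    yield one of smaller key between vectors of the old support, so the earlier cells stay clean. *)
Lemma swap_step b I J w : weight w -> w I != 0 -> w J != 0 -> (b < k)%N -> viol b I J ->
  clean (vkey b I J) w ->
  exists w', [/\ weight w', same_marginals w' w, clean (vkey b I J) w' &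
    (#|obstruction b (co I b) (r b J) w'| < #|obstruction b (co I b) (r b J) w|)%N].
Proof.
move=> [wpos wV] wI wJ bk vIJ cl.
have [vI vJ] := (wV _ wI, wV _ wJ).
have tIJ := viol_trunc vIJ.
case/and3P: (vIJ) => rIJ hb hb1.
set X := splice b J I; set Y := splice b I J.
have cX l : co X l = if (l < b)%N then co J l else co I l by apply: co_splice.
have cY l : co Y l = if (l < b)%N then co I l else co J l by apply: co_splice.
have tX : trunc b X = trunc b J by apply/truncP => l lb; rewrite cX lb.
have tY : trunc b Y = trunc b I by apply/truncP => l lb; rewrite cY lb.
have rX : r b X = r b J by apply/(rank_eq rP).
have rY : r b Y = r b I by apply/(rank_eq rP).
have b0 : (0 < b)%N.
  by case: b tIJ {rIJ hb bk vIJ cl hb1 X Y cX cY tX tY rX rY} => // /eqP[]; apply/truncP.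
have incX : inc X by apply: inc_splice.
have incY : inc Y.
  apply: inc_splice => //; apply: leq_trans hb; rewrite ltnS ltnW //.
  by apply: inc_ltn => //; rewrite prednK.
have nIJ : I != J by apply: contra_neq tIJ => ->.
have nXI : X != I by apply: contra_neq tIJ => <-; rewrite tX.
have nXJ : X != J by apply/eqP => e; move: (cX b); rewrite e ltnn => e'; move: hb; rewrite e' ltnn.
have nYI : Y != I by apply/eqP => e; move: (cY b); rewrite e ltnn => e'; move: hb; rewrite e' ltnn.
have nYJ : Y != J by apply: contra_neq tIJ => <-; rewrite tY.
have nXY : X != Y by apply: contra_neq tIJ => e; rewrite -tY -e tX.
(* [m] is the minimum of [w I] and [w J], so one of the two loses all its mass. *)
have [m [mpos mI mJ mz]] : exists m, [/\ pos m, pos (w I - m), pos (w J - m) &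
    (w I == m) || (w J == m)].
  case/orP: (cone_total posP (w I - w J)) => h.
    by exists (w J); split; rewrite ?wpos ?subrr ?cone0 // eqxx orbT.
  by exists (w I); split; rewrite ?wpos ?subrr ?cone0 ?eqxx // -opprB.
pose w' := swap b I J m w.
have wI' : w' I = w I - m.
  by rewrite /w' /swap /point_mass -/X -/Y eqxx (negPf nIJ) eq_sym (negPf nXI)
     eq_sym (negPf nYI) subr0 !addr0.
have wJ' : w' J = w J - m.
  by rewrite /w' /swap /point_mass -/X -/Y eqxx ![J == _]eq_sym (negPf nIJ)
     (negPf nXJ) (negPf nYJ) subr0 !addr0.
have wX' : w' X = w X + m.
  by rewrite /w' /swap /point_mass -/X -/Y eqxx (negPf nXI) (negPf nXJ) (negPf nXY) !subr0 addr0.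
have wY' : w' Y = w Y + m.
  by rewrite /w' /swap /point_mass -/X -/Y eqxx (negPf nYI) (negPf nYJ) eq_sym (negPf nXY) !subr0 addr0.
have wL' L : L != I -> L != J -> L != X -> L != Y -> w' L = w L.
  by move=> /negPf eI /negPf eJ /negPf eX /negPf eY;
    rewrite /w' /swap /point_mass -/X -/Y eI eJ eX eY !subr0 !addr0.
have supp L : w' L != 0 -> [\/ w L != 0, L = X | L = Y].
  case: (eqVneq L I) => [->|LI]; first by constructor 1.
  case: (eqVneq L J) => [->|LJ]; first by constructor 1.
  case: (eqVneq L X) => [->|LX]; first by constructor 2.
  case: (eqVneq L Y) => [->|LY]; first by constructor 3.
  by rewrite wL' // => ?; constructor 1.
exists w'; split.
- split=> [L|L /supp[/wV//|->//|->//]].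
  case: (eqVneq L I) => [->|LI]; first by rewrite wI'.
  case: (eqVneq L J) => [->|LJ]; first by rewrite wJ'.
  case: (eqVneq L X) => [->|LX]; first by rewrite wX' coneD.
  case: (eqVneq L Y) => [->|LY]; first by rewrite wY' coneD.
  by rewrite wL'.
- exact: (swap_marginals b I J m w).
- move=> b' K L bk' /supp sK /supp sL vKL; rewrite leqNgt; apply/negP.
  rewrite /vkey key_lt ?co_le ?(rank_lt rP) //.
  have below K0 L0 : w K0 != 0 -> w L0 != 0 -> viol b' K0 L0 ->
      (vkey b' K0 L0 < vkey b I J)%N -> False.
    by move=> wK0 wL0 v0; rewrite ltnNge (cl b' K0 L0).
  have {}below K0 L0 : w K0 != 0 -> w L0 != 0 -> viol b' K0 L0 ->
      (b' < b)%N || (b' == b) && ((co K0 b' < co I b)%N ||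
         (co K0 b' == co I b) && (r b' L0 < r b J)%N) -> False.
    by move=> wK0 wL0 v0 h; apply: (below K0 L0) => //; rewrite /vkey key_lt ?co_le ?(rank_lt rP).
  (* At a position before [b], only entries before [b] matter: [X] can be replaced by [J] and [Y] by
     [I]. *)
  case/orP => [lb|/andP[/eqP e]].
    have lift Z : [\/ w Z != 0, Z = X | Z = Y] ->
        exists2 Z0, w Z0 != 0 & trunc b Z0 = trunc b Z.
      by case=> [wZ|->|->]; [exists Z|exists J|exists I].
    have [K0 wK0 /truncP eK] := lift K sK.
    have [L0 wL0 /truncP eL] := lift L sL.
    apply: (below K0 L0) => //; last by rewrite lb.
    move: vKL; rewrite /viol !eK ?eL //; last by apply: leq_ltn_trans lb; apply: leq_pred.
    have re Z Z0 : (forall l, (l < b)%N -> co Z0 l = co Z l) -> r b' Z0 = r b' Z.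
      by move=> h; apply/(rank_eq rP)/truncP => l lb'; apply: h; apply: ltn_trans lb.
    by rewrite (re K K0) // (re L L0).
  subst b'.
  have cXb : co X b = co I b by rewrite cX ltnn.
  have cYb : co Y b = co J b by rewrite cY ltnn.
  have b1 : (b.-1 < b)%N by rewrite prednK.
  have cX1 : co X b.-1 = co J b.-1 by rewrite cX b1.
  have cY1 : co Y b.-1 = co I b.-1 by rewrite cY b1.
  case/and3P: (vKL) => rKL cKL cKL1.
  (* Same position, smaller value: [X] and [Y] have values at least [co I b] there, so [K] is old.
     For [L], replace [X] by [J] or [Y] by [I]: the prefix is the same and the value at [b] still
     exceeds [co K b]. *)
  case/orP => [lv|/andP[/eqP ev lp]].
    have wK : w K != 0.
      by case: sK => // eK; move: lv; rewrite eK ?cXb ?cYb ?ltnn // ltnNge (ltnW hb).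
    case: sL => [wL|eL|eL]; first by apply: (below K L); rewrite // eqxx lv orbT.
      apply: (below K J); rewrite // ?eqxx ?lv ?orbT //.
      by move: rKL cKL cKL1; rewrite /viol eL rX cXb cX1 => -> h ->; rewrite andbT (ltn_trans lv).
    apply: (below K I); rewrite // ?eqxx ?lv ?orbT //.
    by move: rKL cKL cKL1; rewrite /viol eL rY cYb cY1 => -> h ->; rewrite andbT lv.
  (* Same value, smaller rank: [X] and [Y] have ranks at least [r b J], so [L] is old. [K] cannot be
     [Y], whose value is too large, and if [K] is [X] then [I], with the same value and a larger
     rank, violates with [L] as well. *)
  have wL : w L != 0.
    by case: sL => // eL; move: lp; rewrite eL ?rX ?rY ?ltnn // ltnNge (ltnW rIJ).
  case: sK => [wK|eK|eK].
  - by apply: (below K L); rewrite // ev !eqxx lp !orbT.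
  - apply: (below I L); rewrite // ?eqxx ?lp ?orbT //.
    by move: cKL cKL1; rewrite /viol eK cXb => -> ->; rewrite !andbT (ltn_trans lp).
  - by move: hb; rewrite -ev eK cYb ltnn.
(* [X] sits exactly in the cell and [Y] exceeds it in both value and rank, so neither obstructs;
   whichever of [I], [J] was emptied did obstruct. *)
- apply: proper_card; apply/properP; split.
    apply/subsetP => L; rewrite !inE => /andP[/supp[->//|->|->]].
      by rewrite cX rX ltnn /= !ltnn !andbF.
    by rewrite cY rY ltnn /= (gtn_eqF hb) (gtn_eqF rIJ) andbF.
  case/orP: mz => /eqP mz; [exists I | exists J]; rewrite !inE.
  - by rewrite wI eqxx rIJ.
  - by rewrite wI' mz subrr eqxx.
  - by rewrite wJ eqxx hb orbT.
  - by rewrite wJ' mz subrr eqxx.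
Qed.

Lemma key_inj b v p b' v' p' : (v <= n)%N -> (v' <= n)%N -> (p < M)%N -> (p' < M)%N ->
  key b v p = key b' v' p' -> [/\ b = b', v = v' & p = p'].
Proof.
move=> hv hv' hp hp' e.
have := key_lt b b' hv hv' hp hp'; have := key_lt b' b hv' hv hp' hp.
by rewrite e ltnn; case: (ltngtP b b') => //= ->; case: (ltngtP v v') => //= ->;
  case: (ltngtP p p').
Qed.

(** Iterates [swap_step] on the cell of key [c]; the size of the obstruction set is the termination
    measure. *)
Lemma swap_clean c w : weight w -> clean c w ->
  exists w', [/\ weight w', same_marginals w' w & clean c.+1 w'].
Proof.
pose at_c (w : vec k n -> G) b I J :=
  [/\ (b < k)%N, w I != 0, w J != 0, viol b I J & vkey b I J = c].
have dec u : clean c u -> (exists b I J, at_c u b I J) \/ clean c.+1 u.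
  move=> cl.
  case: (boolP [exists b : 'I_k, exists I, exists J,
         [&& u I != 0, u J != 0, viol b I J & vkey b I J == c]]); [left|right].
    case/existsP: p => b /existsP[I /existsP[J /and4P[? ? ? /eqP ?]]].
    by exists b, I, J.
  move=> b I J bk uI uJ v.
  rewrite ltn_neqAle cl // andbT; apply: contra i => /eqP e.
  apply/existsP; exists (Ordinal bk); apply/existsP; exists I; apply/existsP; exists J.
  by rewrite uI uJ v /= -e.
move=> ww cl; case: (dec w cl) => [[b [I [J hIJ]]]|?]; last by exists w.
have [N] := ubnP #|obstruction b (co I b) (r b J) w|.
have [bk _ _ _ ec] := hIJ.
elim: N w ww cl {hIJ} => // N IH w ww cl hN.
case: (dec w cl) => [[b' [I' [J' [bk' wI wJ v e]]]]|?]; last by exists w.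
(* Injectivity of [key] puts every violation of key [c] in the same cell, so the measure refers to
   one fixed obstruction set. *)
have [eb ev ep] : [/\ b' = b, co I' b' = co I b & r b' J' = r b J].
  by apply: key_inj; rewrite ?co_le ?(rank_lt rP) // -/(vkey b' I' J') e -ec.
rewrite -{}ev -{}ep in hN IH; subst b'.
rewrite -e in cl; have [w1 [ww1 m1 cl1 lt1]] := swap_step ww wI wJ bk v cl.
rewrite e in cl1.
have [w2 [ww2 m2 cl2]] := IH w1 ww1 cl1 (leq_trans lt1 hN).
by exists w2; split => // a p ak; rewrite m2 // m1.
Qed.

Theorem exists_compatible w : weight w ->
  exists w', [/\ weight w', same_marginals w' w & compatible w'].
Proof.
move=> ww.
(* [key k 0 0] lies above the key of every cell at a position [b < k]. *)
have [w' [ww' m' cl]] : exists w', [/\ weight w', same_marginals w' w & clean (key k 0 0) w'].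
  elim: (key k 0 0) => [|c [w1 [ww1 m1 cl1]]]; first by exists w; split => // ? *; rewrite leq0n.
  have [w2 [ww2 m2 cl2]] := swap_clean ww1 cl1.
  by exists w2; split => // a p ak; rewrite m2 // m1.
exists w'; split => // I J wI wJ b bk; apply/negP => v.
have := cl b I J bk wI wJ v; apply/negP; rewrite -ltnNge /vkey.
have M0 : (0 < M)%N by apply: leq_ltn_trans (rank_lt rP b J).
by rewrite key_lt ?co_le ?(rank_lt rP) // bk.
Qed.

End Weights.

(** * Uniqueness of compatible weights *)

Section Uniqueness.
Variables (k n M : nat) (r : nat -> vec k n -> nat).
Hypothesis rP : prefix_rank M r.
Variables (G : zmodType) (pos : pred G).
Hypothesis posP : total_cone pos.
Implicit Types (w : vec k n -> G) (I J P Q : vec k n).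

Definition prefix_sum b w P : G := \sum_(I | trunc b I == P) w I.

Lemma prefix_sum_neq0 b w P : prefix_sum b w P != 0 ->
  exists2 I, trunc b I = P & w I != 0.
Proof.
move=> h; case: (boolP [exists I, (trunc b I == P) && (w I != 0)]).
  by case/existsP => I /andP[/eqP]; exists I.
move=> no; case/eqP: h; apply: big1 => I tI; apply/eqP; apply: contraNT no => wI.
by apply/existsP; exists I; rewrite tI.
Qed.

Lemma prefix_sumB b w w' P :
  prefix_sum b (fun I => w I - w' I) P = prefix_sum b w P - prefix_sum b w' P.
Proof. exact: sumrB. Qed.

Lemma not_pos_supp b w w' Q : weight pos w ->
  ~~ pos (prefix_sum b (fun I => w I - w' I) Q) -> exists2 I, trunc b I = Q & w' I != 0.
Proof.
move=> [wp _] h; apply: prefix_sum_neq0; apply: contraNneq h => e.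
by rewrite prefix_sumB e subr0; apply: (cone_sum posP).
Qed.

Lemma trunc_succ b I J : trunc b I = trunc b J -> co I b = co J b ->
  trunc b.+1 I = trunc b.+1 J.
Proof.
move=> /truncP h e; apply/truncP => l; rewrite ltnS leq_eqVlt => /predU1P[-> //|].
exact: h.
Qed.

Lemma trunc_trunc b c I : (b <= c)%N -> trunc b (trunc c I) = trunc b I.
Proof. by move=> bc; apply/truncP => l lb; rewrite co_trunc (leq_trans lb). Qed.

(** Suppose [w] exceeds [w'] at the minimal prefix [P]. The marginal of the value [co P b] forces a
    deficit at some [Q] with that value, and the induction hypothesis forces one at some [R]
    extending the same shorter prefix. By minimality [Q] has a larger rank and [R] a larger value,
    so vectors of the support of [w'] above [Q] and [R] form a violation. *)
Lemma prefix_sum_step b w w' P :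
  (b < k)%N -> weight pos w -> weight pos w' -> compatible r w' ->
  same_marginals w w' ->
  (forall P, prefix_sum b (fun I => w I - w' I) P = 0) ->
  (forall Q, prefix_sum b.+1 (fun I => w I - w' I) Q != 0 ->
     (co P b * M + r b P <= co Q b * M + r b Q)%N) ->
  pos (prefix_sum b.+1 (fun I => w I - w' I) P) ->
  prefix_sum b.+1 (fun I => w I - w' I) P = 0.
Proof.
set d := fun I => w I - w' I.
move=> bk ww ww' cw mar IH minP pP; apply/eqP/negPn/negP => /[dup] nP /prefix_sum_neq0[X tX dX].
have incX : inc X.
  case: (eqVneq (w X) 0) => [wX|/(proj2 ww) //].
  by move: dX; rewrite /d wX sub0r oppr_eq0 => /(proj2 ww').
have cPX l : (l <= b)%N -> co P l = co X l by move=> lb; rewrite -tX co_trunc ltnS lb.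
have col : \sum_(Q | co Q b == co P b) prefix_sum b.+1 d Q = 0.
  have /eqP := mar b (pred1 (co P b)) bk; rewrite -subr_eq0 -sumrB => /eqP e.
  rewrite -[RHS]e [RHS](partition_big (trunc b.+1) (fun Q => co Q b == co P b)) /=.
    apply: eq_bigr => Q /eqP cQ; apply: eq_bigl => I.
    case: (eqVneq (trunc b.+1 I) Q) => [tQ|_]; rewrite ?andbF // andbT.
    by rewrite -cQ -tQ co_trunc ltnSn eqxx.
  by move=> I; rewrite co_trunc ltnSn.
have row : \sum_(Q | trunc b Q == trunc b P) prefix_sum b.+1 d Q = 0.
  rewrite -[RHS](IH (trunc b P)) [RHS](partition_big (trunc b.+1) (fun Q => trunc b Q == trunc b P)) /=.
    apply: eq_bigr => Q /eqP tQ; apply: eq_bigl => I.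
    case: (eqVneq (trunc b.+1 I) Q) => [eQ|_]; rewrite ?andbF // andbT.
    by rewrite -tQ -eQ trunc_trunc // eqxx.
  by move=> I; rewrite trunc_trunc.
have [Q /eqP cQ nQ] := cone_sum_eq0 posP col (eqxx _) pP (elimN eqP nP).
have [R /eqP tR nR] := cone_sum_eq0 posP row (eqxx _) pP (elimN eqP nP).
have [I tI wI] := not_pos_supp ww nQ.
have [J tJ wJ] := not_pos_supp ww nR.
have nz S : ~~ pos (prefix_sum b.+1 d S) -> prefix_sum b.+1 d S != 0.
  by apply: contraNneq => ->; apply: cone0.
have kQ := minP Q (nz _ nQ); have kR := minP R (nz _ nR).
(* A deficit cannot occur at [P] itself, so a prefix with a deficit differs from [P] either in its
   last value or before it; this makes both inequalities strict. *)
have uniq S Z : ~~ pos (prefix_sum b.+1 d S) -> trunc b.+1 Z = S -> trunc b S = trunc b P ->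
    co S b <> co P b.
  move=> nS tZ tS cS; case/negP: nS; suff -> : S = P by [].
  rewrite -tZ -tX; apply: trunc_succ; last by rewrite -(cPX b) // -cS -tZ co_trunc ltnSn.
  by rewrite -[LHS](trunc_trunc _ (leqnSn b)) tZ tS -tX trunc_trunc.
have rR : r b R = r b P by apply/(rank_eq rP).
have lR : (co P b < co R b)%N.
  rewrite ltn_neqAle; apply/andP; split; first by apply/eqP => e; apply: (uniq R J).
  move: kR; rewrite rR leq_add2r leq_mul2r => /orP[/eqP M0|//].
  by have := rank_lt rP b P; rewrite M0.
have lQ : (r b P < r b Q)%N.
  rewrite ltn_neqAle; apply/andP; split; last by move: kQ; rewrite cQ leq_add2l.
  by apply/eqP => /(rank_eq rP) e; apply: (uniq Q I).
have rI : r b I = r b Q by apply/(rank_eq rP); rewrite -tI trunc_trunc.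
have rJ : r b J = r b P by rewrite -rR; apply/(rank_eq rP); rewrite -tJ trunc_trunc.
have cI : co I b = co P b by rewrite -cQ -tI co_trunc ltnSn.
have cJ : co J b = co R b by rewrite -tJ co_trunc ltnSn.
have /negP := cw I J wI wJ b bk; apply; rewrite /viol rI rJ lQ cI cJ lR /=.
(* There is only one empty prefix, which excludes [b = 0]. For positive [b], the last clause of
   [viol] holds because [J] shares the shorter prefix of [P] and [P] is a prefix of the increasing
   [X]. *)
case: b {IH nz minP nP pP dX tX col row nQ nR tI tJ uniq rR lR cQ kQ kR cI cJ} lQ bk tR cPX rI rJ
  => [|b] lQ bk tR cPX rI rJ.
  by move: lQ; rewrite (_ : r 0%N P = r 0%N Q) ?ltnn //; apply/(rank_eq rP)/truncP.
have -> : co J b = co P b.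
  have /(rank_eq rP)/truncP h : r b.+1 J = r b.+1 P by [].
  by apply: h.
by rewrite !cPX //; apply: inc_ltn.
Qed.

(* A counterexample prefix with minimal next value [co P b], then minimal rank [r b P], exhibits
   a violation (see [prefix_sum_step]). *)
Theorem compatible_unique w w' :
  weight pos w -> weight pos w' -> compatible r w -> compatible r w' ->
  \sum_I w I = \sum_I w' I -> same_marginals w w' -> w =1 w'.
Proof.
move=> ww ww' cw cw' tot mar.
have main b : (b <= k)%N -> forall P, prefix_sum b (fun I => w I - w' I) P = 0.
  elim: b => [_ P|b IH bk].
    case: (eqVneq P (trunc 0 P)) => [eP|nP].
      rewrite /prefix_sum (eq_bigl predT) ?sumrB ?tot ?subrr // => I /=.
      by apply/eqP; rewrite eP; apply/truncP.
    rewrite /prefix_sum big_pred0 // => I; apply: contraNF nP => /eqP <-.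
    by apply/eqP/truncP.
  have {}IH := IH (ltnW bk).
  move=> P0; apply/eqP/negPn/negP => n0.
  case: (arg_minnP (P := fun P => prefix_sum b.+1 (fun I => w I - w' I) P != 0)
           (fun P => co P b * M + r b P)%N n0) => P nP minP.
  have opp c S : prefix_sum c (fun I => w' I - w I) S = - prefix_sum c (fun I => w I - w' I) S.
    by rewrite !prefix_sumB opprB.
  (* A deficit at the minimal prefix becomes an excess once [w] and [w'] are exchanged. *)
  case/orP: (cone_total posP (prefix_sum b.+1 (fun I => w I - w' I) P)) => pP.
    by case/eqP: nP; apply: prefix_sum_step.
  case/eqP: nP; apply/eqP; rewrite -oppr_eq0 -opp; apply/eqP.
  apply: prefix_sum_step; rewrite ?opp //.
  - by move=> a p ak; rewrite mar.
  - by move=> S; rewrite opp IH oppr0.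
  - by move=> S; rewrite opp oppr_eq0; apply: minP.
move=> I; apply/eqP; rewrite -subr_eq0; apply/eqP.
have tk J : trunc k J = J by apply: co_inj => l lk; rewrite co_trunc lk.
rewrite -[RHS](main k (leqnn k) I) /prefix_sum (eq_bigl (pred1 I)) ?big_pred1_eq // => J.
by rewrite tk.
Qed.

End Uniqueness.

(** * Noncrossing and nonnesting through prefix ranks *)

Section Ranks.
Variables k n : nat.
Implicit Types I J : vec k n.

(** The prefix read as a number in base [n.+1] whose most significant digit is the last entry: the
    last disagreement decides. *)
Fixpoint revlex b I : nat :=
  if b is b'.+1 then (co I b' * n.+1 ^ b' + revlex b' I)%N else 0%N.

Lemma revlex_bound b I : (revlex b I < n.+1 ^ b)%N.
Proof.
elim: b => //= b IH; rewrite expnS mulSn addnC -addSn leq_add // leq_mul2r co_le.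
by rewrite orbT.
Qed.

Lemma revlex_lt b I : (revlex b I < n.+1 ^ k)%N.
Proof.
case: (leqP b k) => [bk|/ltnW].
  by apply: leq_trans (revlex_bound b I) _; apply: leq_pexp2l.
elim: b => [|b IH]; first by rewrite leqn0 => /eqP ->.
rewrite leq_eqVlt => /predU1P[<-|]; first exact: revlex_bound.
by rewrite ltnS /= => kb; rewrite co_out // IH.
Qed.

Lemma revlexS b I J : (revlex b.+1 I < revlex b.+1 J)%N =
  (co I b < co J b)%N || (co I b == co J b) && (revlex b I < revlex b J)%N.
Proof.
have := revlex_bound b I; have := revlex_bound b J => /=.
move: (n.+1 ^ b)%N (revlex b I) (revlex b J) => N x y yN xN.
case: (ltngtP (co I b) (co J b)) => [h|h|->] /=.
- apply/idP; have : ((co I b).+1 * N <= co J b * N)%N by rewrite leq_mul2r h orbT.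
  rewrite mulSn; lia.
- apply/negbTE; have : ((co J b).+1 * N <= co I b * N)%N by rewrite leq_mul2r h orbT.
  rewrite mulSn; lia.
- by rewrite ltn_add2l.
Qed.

Lemma revlexP b I J : (revlex b I < revlex b J)%N <->
  exists a, [/\ (a < b)%N, (co I a < co J a)%N &
    forall l, (a < l)%N -> (l < b)%N -> co I l = co J l].
Proof.
elim: b => [|b IH]; first by split=> // -[a []].
rewrite revlexS; split.
  case/orP => [h|/andP[/eqP e /IH[a [ab h eqs]]]].
    by exists b; split => // l bl; rewrite ltnS leqNgt bl.
  exists a; split => // [|l al]; first by rewrite ltnS ltnW.
  by rewrite ltnS leq_eqVlt => /predU1P[->|]; [|apply: eqs].
case=> a [ab h eqs]; move: ab; rewrite ltnS leq_eqVlt => /predU1P[e|ab].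
  by rewrite -e h.
rewrite (eqs b) // eqxx /=; apply/orP; right; apply/IH; exists a; split => // l al lb.
by apply: eqs => //; apply: ltnW.
Qed.

Lemma revlex_eq b I J : revlex b I = revlex b J <-> trunc b I = trunc b J.
Proof.
rewrite truncP; elim: b => [|b IH]; first by split.
split=> [e|h]; last first.
  by rewrite /= h // (proj2 IH) // => l lb; apply: h; apply: ltnW.
have := revlexS b I J; have := revlexS b J I; rewrite e ltnn.
case: (ltngtP (co I b) (co J b)) => //= eb _ _ l; rewrite ltnS leq_eqVlt.
case/predU1P => [->//|]; apply: (proj1 IH).
by move: e => /=; rewrite eb => /addnI.
Qed.

Definition corevlex b I : nat := ((n.+1 ^ k).-1 - revlex b I)%N.

Lemma revlex_rank : prefix_rank (n.+1 ^ k) revlex.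
Proof. by split; [apply: revlex_lt | apply: revlex_eq]. Qed.

Lemma corevlex_rank : prefix_rank (n.+1 ^ k) corevlex.
Proof.
split=> [b I|b I J]; rewrite /corevlex.
  have : (0 < n.+1 ^ k)%N by rewrite expn_gt0.
  by lia.
rewrite -revlex_eq; have := revlex_lt b I; have := revlex_lt b J.
by split; lia.
Qed.

Lemma corevlex_lt b I J : (corevlex b J < corevlex b I)%N = (revlex b I < revlex b J)%N.
Proof. by have := revlex_lt b I; have := revlex_lt b J; rewrite /corevlex; lia. Qed.

(** With [a] the last disagreement before [b], this is a crossing of the two arcs from [a] to [b].
    The clause [co J b.-1 < co I b] amounts to [co J a < co I b]: either [a = b.-1], or [I] and [J]
    agree at [b.-1] and [I] is increasing. *)
Lemma viol_corevlexP b I J : inc I -> inc J -> (b < k)%N ->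
  viol corevlex b I J <-> exists a, [/\ (a < b)%N,
    forall l, (a < l)%N -> (l < b)%N -> co I l = co J l &
    [&& co I a < co J a, co J a < co I b & co I b < co J b]%N].
Proof.
move=> vI vJ bk; split.
  case/and3P; rewrite corevlex_lt => /revlexP[a [ab h eqs]] h1 h2; exists a; split => //.
  rewrite h h1 andbT /=; apply: leq_ltn_trans h2.
  have : (a <= b.-1)%N by lia.
  rewrite leq_eqVlt => /predU1P[->//|ab1]; apply: ltnW; apply: inc_ltn => //; lia.
case=> a [ab eqs /and3P[h1 h2 h3]]; apply/and3P; split => //.
  by rewrite corevlex_lt; apply/revlexP; exists a.
have : (a <= b.-1)%N by lia.
rewrite leq_eqVlt => /predU1P[<-//|ab1]; rewrite -eqs //; last by lia.
by apply: inc_ltn => //; lia.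
Qed.

(** Here the arc of [J] encloses that of [I]. The last clause of [viol] comes from
    [co J b.-1 <= co I b.-1 < co I b]. *)
Lemma viol_revlexP b I J : inc I -> inc J -> (b < k)%N ->
  viol revlex b I J <-> exists a, [/\ (a < b)%N,
    forall l, (a < l)%N -> (l < b)%N -> co I l = co J l &
    (co J a < co I a)%N && (co I b < co J b)%N].
Proof.
move=> vI vJ bk; split.
  case/and3P => /revlexP[a [ab h eqs]] h1 h2; exists a; split => //; last by rewrite h h1.
  by move=> l al lb; rewrite eqs.
case=> a [ab eqs /andP[h1 h2]]; apply/and3P; split => //.
  by apply/revlexP; exists a; split => // l al lb; rewrite eqs.
apply: (@leq_ltn_trans (co I b.-1)); last by apply: inc_ltn => //; lia.
have : (a <= b.-1)%N by lia.
rewrite leq_eqVlt => /predU1P[<-//|ab1]; first by apply: ltnW.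
by rewrite eqs //; lia.
Qed.

Lemma noncrossingP I J : inc I -> inc J ->
  noncrossing k (seqv I) (seqv J) <-> compat corevlex I J /\ compat corevlex J I.
Proof.
move=> vI vJ; split.
  move=> h; split=> b bk; apply/negP => v.
    have [a [ab eqs hx]] := proj1 (viol_corevlexP vI vJ bk) v.
    have := h a.+1 b.+1 isT ab bk; rewrite /ent /= !nth_seqv /cross hx => /(_ _)/negP[] //.
    by case=> // l al lb; rewrite /= !nth_seqv eqs.
  have [a [ab eqs hx]] := proj1 (viol_corevlexP vJ vI bk) v.
  have := h a.+1 b.+1 isT ab bk; rewrite /ent /= !nth_seqv /cross hx orbT => /(_ _)/negP[] //.
  by case=> // l al lb; rewrite /= !nth_seqv eqs.
case=> h1 h2 [//|a] [//|b] _ ab bk eqs; rewrite /ent /= !nth_seqv.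
have {}eqs l : (a < l)%N -> (l < b)%N -> co I l = co J l.
  by move=> al lb; have := eqs l.+1 al lb; rewrite /ent /= !nth_seqv.
apply/negP => /orP[] h; [case/negP: (h1 b bk)|case/negP: (h2 b bk)];
  by apply/viol_corevlexP => //; exists a; split => // l al lb; rewrite eqs.
Qed.

(** [viol] only sees nestings whose vectors agree between the two ends, while [nonnesting] excludes
    all of them. Taking the first [b'] after [a] with [f < g], then the last [a'] before it with
    [g < f], leaves only equality in between. *)
Lemma closest_sign_change (f g : nat -> nat) a b : (a < b)%N -> (g a < f a)%N -> (f b < g b)%N ->
  exists a' b', [/\ (a' < b')%N, (b' <= b)%N, (g a' < f a')%N, (f b' < g b')%N &
    forall l, (a' < l)%N -> (l < b')%N -> f l = g l].
Proof.
move=> ab ga fb.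
have exb : exists c, (a < c)%N && (f c < g c)%N by exists b; rewrite ab.
case: (ex_minnP exb) => c /andP[ac fc] minc.
have exa : exists d, (d < c)%N && (g d < f d)%N by exists a; rewrite ac.
have bnd d : (d < c)%N && (g d < f d)%N -> (d <= c)%N by case/andP => /ltnW.
case: (ex_maxnP exa bnd) => d /andP[dc gd] maxd.
exists d, c; split => //; first by apply: minc; rewrite ab.
move=> l dl lc; apply/eqP; rewrite eqn_leq; apply/andP; split; rewrite leqNgt; apply/negP => h.
  by have := maxd l; rewrite lc h => /(_ isT); rewrite leqNgt dl.
have : (a <= d)%N by apply: maxd; rewrite ac.
by move=> ad; have := minc l; rewrite h (leq_ltn_trans ad dl) => /(_ isT); rewrite leqNgt lc.
Qed.

Lemma nonnestingP I J : inc I -> inc J ->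
  nonnesting k (seqv I) (seqv J) <-> compat revlex I J /\ compat revlex J I.
Proof.
move=> vI vJ; split.
  move=> h; split=> b bk; apply/negP => v.
    have [a [ab _ /andP[hx hy]]] := proj1 (viol_revlexP vI vJ bk) v.
    have := h a.+1 b.+1 isT ab bk; rewrite /ent /= !nth_seqv /nest hx hy.
    by rewrite (inc_ltn vI ab bk) orbT.
  have [a [ab _ /andP[hx hy]]] := proj1 (viol_revlexP vJ vI bk) v.
  have := h a.+1 b.+1 isT ab bk; rewrite /ent /= !nth_seqv /nest hx hy.
  by rewrite (inc_ltn vJ ab bk).
case=> h1 h2 [//|a] [//|b] _ ab bk; rewrite /ent /= !nth_seqv.
apply/negP => /orP[] /and3P[x1 x2 x3].
  have [a' [b' [ab' bb ga fb eqs]]] := @closest_sign_change _ _ a b ab x1 x3.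
  have bk' : (b' < k)%N by apply: leq_ltn_trans bk.
  by case/negP: (h2 b' bk'); apply/viol_revlexP => //; exists a'; rewrite ga fb.
have [a' [b' [ab' bb ga fb eqs]]] := @closest_sign_change _ _ a b ab x1 x3.
have bk' : (b' < k)%N by apply: leq_ltn_trans bk.
by case/negP: (h1 b' bk'); apply/viol_revlexP => //; exists a'; rewrite ga fb.
Qed.

End Ranks.

(** * Points of the order polytope *)

Lemma nonneg_cone (D : realDomainType) : total_cone (fun x : D => 0 <= x).
Proof.
split=> [x y|x|x]; rewrite ?oppr_ge0; first exact: addr_ge0.
  exact: le_total.
by move=> x0 x1; apply/eqP; rewrite eq_le x1.
Qed.

(** Lexicographic order: the second coordinate is infinitesimal relative to the first. *)
Definition lex_ge0 (x : int * int) : bool := (0 < x.1) || (x.1 == 0) && (0 <= x.2).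

Lemma lex_cone : total_cone lex_ge0.
Proof.
split=> [[x1 x2] [y1 y2]|[x1 x2]|[x1 x2]]; rewrite /lex_ge0 /=; try lia.
by move=> h1 h2; congr pair; lia.
Qed.

Lemma fst_sum (U V : zmodType) (T : finType) (P : pred T) (F : T -> U * V) :
  (\sum_(i | P i) F i).1 = \sum_(i | P i) (F i).1.
Proof. exact: (big_morph fst). Qed.

Lemma snd_sum (U V : zmodType) (T : finType) (P : pred T) (F : T -> U * V) :
  (\sum_(i | P i) F i).2 = \sum_(i | P i) (F i).2.
Proof. exact: (big_morph snd). Qed.

Section Points.
Variables k n : nat.
Hypothesis kn : (k <= n)%N.
Local Notation m := (n - k)%N.
Local Notation vec := (vec k n).

Lemma chi_seqv (D : pzRingType) (I : vec) i j :
  chi D k n (seqv I) i j = (co I i <= i + j + 1)%N%:R.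
Proof. by rewrite mxE /ent /= nth_seqv. Qed.

Lemma sum_chi_entry (D : pzRingType) (w : vec -> D) i j :
  (\sum_I w I *: chi D k n (seqv I)) i j = \sum_(I | (co I i <= i + j + 1)%N) w I.
Proof.
rewrite summxE [RHS]big_mkcond; apply: eq_bigr => I _.
by rewrite mxE chi_seqv; case: ifP => _; rewrite ?mulr1 ?mulr0.
Qed.

Lemma marginals_total (G : zmodType) (w w' : vec -> G) : (0 < k)%N ->
  same_marginals w w' -> \sum_I w I = \sum_I w' I.
Proof. by move=> k1 /(_ 0%N predT k1). Qed.

Lemma marginals_chi (D : pzRingType) (w w' : vec -> D) : same_marginals w w' ->
  \sum_I w I *: chi D k n (seqv I) = \sum_I w' I *: chi D k n (seqv I).
Proof.
move=> mar; apply/matrixP => i j; rewrite !sum_chi_entry.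
exact: (mar i (fun v => v <= i + j + 1)%N).
Qed.

(** Row [a] of the point lists the masses of the values at most [t] for [a < t <= a + m]. Smaller
    thresholds capture no mass and larger ones all of it, so the whole cumulative distribution is
    known; differences give single values, and sums of these any set. *)
Lemma chi_marginals (D : pzRingType) (w w' : vec -> D) :
  (forall I, w I != 0 -> inc I) -> (forall I, w' I != 0 -> inc I) ->
  \sum_I w I = \sum_I w' I ->
  \sum_I w I *: chi D k n (seqv I) = \sum_I w' I *: chi D k n (seqv I) ->
  same_marginals w w'.
Proof.
move=> vw vw' tot eqx a p ak; apply/eqP; rewrite -subr_eq0 -sumrB; apply/eqP.
have vd I : w I - w' I != 0 -> inc I.
  case: (eqVneq (w I) 0) => [->|/vw //]; rewrite sub0r oppr_eq0; exact: vw'.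
have cdf t : \sum_(I | (co I a <= t)%N) (w I - w' I) = 0.
  case: (leqP t a) => [ta|at_].
    apply: big1 => I cI; apply/eqP; apply: contraTT cI => /vd vI.
    by rewrite -ltnNge (leq_ltn_trans ta) // inc_gt.
  case: (ltnP t (a + m + 1)%N) => [tm|tm]; last first.
    have /eqP := tot; rewrite -subr_eq0 -sumrB => /eqP e.
    rewrite -[RHS]e [LHS]big_mkcond; apply: eq_bigr => I _; case: ifP => // /negbT nI.
    apply/esym/eqP; apply: contraNT nI => /vd vI.
    by have := inc_le vI ak; lia.
  have jm : (t - a.+1 < m)%N by lia.
  have := congr1 (fun x : 'M_(k, m) => x (Ordinal ak) (Ordinal jm)) eqx.
  rewrite /= !sum_chi_entry /= => /eqP; rewrite -subr_eq0 -sumrB => /eqP e.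
  by rewrite -[RHS]e; apply: eq_bigl => I; congr (_ <= _)%N; lia.
have pt v : \sum_(I | co I a == v) (w I - w' I) = 0.
  case: v => [|v]; first by rewrite -[RHS](cdf 0%N); apply: eq_bigl => I; rewrite leqn0.
  have := cdf v.+1; rewrite (bigID (fun I => co I a == v.+1)) /=.
  rewrite [X in _ + X](_ : _ = 0) ?addr0; last first.
    by rewrite -[RHS](cdf v); apply: eq_bigl => I; lia.
  by move=> e; rewrite -[RHS]e; apply: eq_bigl => I; lia.
rewrite (partition_big (fun I => inord (co I a) : 'I_n.+1) (fun v => p v)) /=.
  apply: big1 => v pv; rewrite -[RHS](pt v); apply: eq_bigl => I.
  rewrite -val_eqE /= inordK ?ltnS ?co_le //.
  by case: eqP => [->|]; rewrite ?andbF // pv.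
by move=> I; rewrite inordK // ltnS co_le.
Qed.

(** Inverts the map from vectors to vertices: if row [i] of [S] begins at column [la i] ([m] for an
    empty row), the entry is [i + la i + 1]. Strict increase holds because [la] is nondecreasing in
    [i]. *)
Lemma up_set_vec (S : 'I_k -> 'I_m -> bool) :
  (forall i (j j' : 'I_m), (j <= j')%N -> S i j -> S i j') ->
  (forall (i i' : 'I_k) j, (i <= i')%N -> S i' j -> S i j) ->
  exists2 I : vec, inc I & forall (i : 'I_k) (j : 'I_m), (co I i <= i + j + 1)%N = S i j.
Proof.
move=> Sr Sc.
pose q (i : 'I_k) (t : nat) : bool := if insub t is Some j then S i j else true.
have qE i (j : 'I_m) : q i j = S i j by rewrite /q valK.
pose la i := find (q i) (iota 0 m).
have la_le i : (la i <= m)%N by rewrite -[X in (_ <= X)%N](size_iota 0) find_size.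
have laP i (j : 'I_m) : (la i <= j)%N = S i j.
  case: leqP => h; last first.
    by have := before_find 0%N h; rewrite nth_iota ?add0n ?qE // ltn_ord.
  have lm : (la i < m)%N by apply: leq_ltn_trans (ltn_ord j).
  have := @nth_find _ 0%N (q i) (iota 0 m); rewrite has_find size_iota => /(_ lm).
  rewrite nth_iota // add0n (qE i (Ordinal lm)) => Sl; apply/esym; exact: Sr Sl.
pose f l := if insub l is Some i then (l + la i + 1)%N else 0%N.
have fE (i : 'I_k) : f i = (i + la i + 1)%N by rewrite /f valK.
have fn l : (f l <= n)%N.
  by rewrite /f; case: insubP => // i _ <- /=; have := la_le i; have := ltn_ord i; lia.
exists (mkvec k n f) => [|i j]; last by rewrite co_mkvec // fE -laP; lia.
apply: inc_intro => l lk; rewrite !co_mkvec ?(ltnW lk) //.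
  by rewrite (fE (Ordinal lk)); lia.
have lk' := ltnW lk; rewrite (fE (Ordinal lk')) (fE (Ordinal lk)) /=.
suff : (la (Ordinal lk') <= la (Ordinal lk))%N by lia.
rewrite leqNgt; apply/negP => h.
have jm := leq_trans h (la_le _).
have := laP (Ordinal lk) (Ordinal jm); rewrite leqnn => /esym S1.
have := laP (Ordinal lk') (Ordinal jm); rewrite (Sc _ _ _ _ S1) //= leqNgt h //.
Qed.

(* Peel off the smallest positive level of [x]. *)
Lemma order_cone_sum (D : realDomainType) (x : 'M[D]_(k, m)) (c : D) :
  0 <= c -> (forall i j, 0 <= x i j <= c) ->
  (forall i (j j' : 'I_m), (j <= j')%N -> x i j <= x i j') ->
  (forall (i i' : 'I_k) j, (i <= i')%N -> x i' j <= x i j) ->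
  exists w : vec -> D, [/\ weight (fun y => 0 <= y) w, \sum_I w I = c &
    \sum_I w I *: chi D k n (seqv I) = x].
Proof.
have [N] := ubnP #|[set ij : 'I_k * 'I_m | 0 < x ij.1 ij.2]|.
elim: N x c => // N IH x c hN c0 xb xr xc.
have [I vI cI] : exists2 I : vec, inc I &
    forall (i : 'I_k) (j : 'I_m), (co I i <= i + j + 1)%N = (0 < x i j).
  apply: up_set_vec => [i j j' jj|i i' j ii] h; apply: lt_le_trans h _; [exact: xr|exact: xc].
have x0 i j : ~~ (0 < x i j) -> x i j = 0.
  by rewrite -leNgt => h; apply/eqP; rewrite eq_le h; case/andP: (xb i j).
have wt (d : D) : 0 <= d -> weight (fun y : D => 0 <= y) (point_mass I d).
  move=> d0; split=> L; rewrite /point_mass; first by case: ifP.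
  by case: (eqVneq L I) => [->|]; rewrite ?eqxx.
have tot (d : D) : \sum_L point_mass I d L = d by rewrite sum_point_mass.
have ch (d : D) i j : (\sum_L point_mass I d L *: chi D k n (seqv L)) i j = d * (0 < x i j)%R%:R.
  by rewrite sum_chi_entry sum_point_mass cI; case: ifP => _; rewrite ?mulr1 ?mulr0.
(* If no positive entry lies below [c], then [x] is [c] times the vertex of its own support. *)
case: (boolP [exists ij : 'I_k * 'I_m, 0 < x ij.1 ij.2 < c]) => [|none]; last first.
  exists (point_mass I c); split; [exact: wt|exact: tot|].
  apply/matrixP => i j; rewrite ch; case: (boolP (0 < x i j)) => [xp|/x0->]; last by rewrite mulr0.
  rewrite mulr1; apply/eqP; rewrite eq_le (andP (xb i j)).2 andbT leNgt.
  by apply: contra none => xl; apply/existsP; exists (i, j); rewrite /= xp xl.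
case/existsP => ij0 /andP[p0 l0].
case: (@arg_minP _ _ _ ij0 (fun ij => 0 < x ij.1 ij.2) (fun ij => x ij.1 ij.2) p0)
  => -[i1 j1] /= p1 min1.
set d := x i1 j1 in p1 min1 *.
have dc : d < c by apply: le_lt_trans l0; apply: min1.
have dx i j : 0 < x i j -> d <= x i j by move=> h; apply: (min1 (i, j)).
pose x' : 'M[D]_(k, m) := \matrix_(i, j) (x i j - d * (0 < x i j)%R%:R).
have x'p i j : 0 <= x' i j.
  rewrite mxE; case: (boolP (0 < x i j)) => [/dx h|/x0->]; first by rewrite mulr1 subr_ge0.
  by rewrite mulr0 subr0.
have x'm i j i' j' : x i j <= x i' j' -> x' i j <= x' i' j'.
  move=> h; case: (boolP (0 < x i j)) => [xp|nx].
    by rewrite !mxE xp (lt_le_trans xp h) lerD2r.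
  by rewrite [x' i j]mxE x0 // ltxx mulr0 subr0.
have [w [ww wc wx]] : exists w : vec -> D, [/\ weight (fun y => 0 <= y) w, \sum_I w I = c - d &
    \sum_I w I *: chi D k n (seqv I) = x'].
  apply: IH => [||i j|i j j' jj|i i' j ii].
  - rewrite ltnS in hN; apply: (leq_trans _ hN); apply: proper_card; apply/properP; split.
      apply/subsetP => -[i j]; rewrite !inE /= mxE.
      by case: (boolP (0 < x i j)) => // /x0->; rewrite mulr0 subr0 ltxx.
    by exists (i1, j1); rewrite !inE //= mxE p1 mulr1 subrr ltxx.
  - by rewrite subr_ge0 ltW.
  - rewrite x'p mxE; case: (boolP (0 < x i j)) => [_|/x0->].
      by rewrite mulr1 lerD2r; case/andP: (xb i j).
    by rewrite mulr0 subr0 subr_ge0 ltW.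
  - exact/x'm/xr.
  - exact/x'm/xc.
have [wd1 wd2] := wt d (ltW p1); have [w1 w2] := ww.
exists (fun L => w L + point_mass I d L); split.
- split=> [L|L]; first exact: addr_ge0.
  by case: (eqVneq (w L) 0) => [->|/w2 //]; rewrite add0r; apply: wd2.
- by rewrite big_split /= wc tot subrK.
apply/matrixP => i j; under eq_bigr do rewrite scalerDl.
by rewrite big_split /= wx mxE ch mxE subrK.
Qed.

Lemma order_polytope_sum (R : realFieldType) (x : 'M[R]_(k, m)) : in_order_polytope x ->
  exists w : vec -> R, [/\ weight (fun y => 0 <= y) w, \sum_I w I = 1 &
    \sum_I w I *: chi R k n (seqv I) = x].
Proof.
case=> xb xr xc; apply: order_cone_sum => // [i j [j' j'm]|i [i' i'k] j] /=.
  elim: j' j'm => [|j' IH] j'm; first by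
    rewrite leqn0 => /eqP e; rewrite (_ : j = Ordinal j'm) //; apply: val_inj.
  rewrite leq_eqVlt => /predU1P[e|]; first by rewrite (_ : j = Ordinal j'm) //; apply: val_inj.
  by rewrite ltnS => /(IH (ltnW j'm)) h; apply: le_trans h _; apply: xr.
elim: i' i'k => [|i' IH] i'k; first by
  rewrite leqn0 => /eqP e; rewrite (_ : i = Ordinal i'k) //; apply: val_inj.
rewrite leq_eqVlt => /predU1P[e|]; first by rewrite (_ : i = Ordinal i'k) //; apply: val_inj.
by rewrite ltnS => /(IH (ltnW i'k)) h; apply: le_trans h; apply: xc.
Qed.

(** The two vertices are the up-set generated by the cell [(a, b)] and that up-set without its
    generator. *)
Lemma delta_chi (a : 'I_k) (b : 'I_m) : exists I J : vec, [/\ inc I, inc J &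
  delta_mx a b = chi int k n (seqv I) - chi int k n (seqv J)].
Proof.
have [I vI cI] := @up_set_vec (fun i j => (i <= a)%N && (b <= j)%N)
  ltac:(by move=> ? ? ? ?; lia) ltac:(by move=> ? ? ? ?; lia).
have [J vJ cJ] := @up_set_vec (fun i j => [&& (i <= a)%N, (b <= j)%N & (i < a)%N || (b < j)%N])
  ltac:(by move=> ? ? ? ?; lia) ltac:(by move=> ? ? ? ?; lia).
exists I, J; split => //; apply/matrixP => i j; rewrite mxE [RHS]mxE [X in _ + X]mxE !chi_seqv cI cJ.
rewrite -!val_eqE /=.
by case: (ltngtP i a); case: (ltngtP b j); rewrite ?andbF ?subrr ?subr0.
Qed.

End Points.

(** * Triangulation and unimodularity *)

Section Triangulation.
Variables (k n M : nat) (r : nat -> vec k n -> nat) (C : seq nat -> seq nat -> Prop).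
Hypotheses (k1 : (1 <= k)%N) (kn : (k <= n)%N) (rP : prefix_rank M r).
Hypothesis CP : forall I J : vec k n, inc I -> inc J ->
  C (seqv I) (seqv J) <-> compat r I J /\ compat r J I.
Local Notation vec := (vec k n).
Local Notation face := (flag_face C k n).

Lemma sum_seqv (V : zmodType) s (F : seq nat -> V) : face s ->
  \sum_(I <- s) F I = \sum_(I : vec | seqv I \in s) F (seqv I).
Proof.
case=> us vs _.
have pe : perm_eq s (map (@seqv k n) [seq I : vec <- index_enum vec | seqv I \in s]).
  apply: uniq_perm => // [|I].
    by rewrite map_inj_uniq; [apply/filter_uniq/index_enum_uniq | apply: seqv_inj].
  apply/idP/mapP => [sI|[J]]; last by rewrite mem_filter => /andP[sJ _] ->.
  have eI := seqv_mkvec (vs I sI).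
  by exists (mkvec k n (nth 0%N I)); rewrite ?mem_filter eI // sI mem_index_enum.
by rewrite (perm_big _ pe) big_map big_filter.
Qed.

(** Extension by zero turns coefficients on different faces into functions on one finite type, where
    they can be compared. *)
Definition extend (D : nmodType) (s : seq (seq nat)) (lam : seq nat -> D) (I : vec) : D :=
  if seqv I \in s then lam (seqv I) else 0.

Lemma sum_extend (D : zmodType) s (lam : seq nat -> D) : face s ->
  \sum_I extend s lam I = \sum_(I <- s) lam I.
Proof. by move=> fs; rewrite (sum_seqv _ fs) [RHS]big_mkcond. Qed.

Lemma sum_extend_chi (D : pzRingType) s (lam : seq nat -> D) : face s ->
  \sum_I extend s lam I *: chi D k n (seqv I) = \sum_(I <- s) lam I *: chi D k n I.
Proof.
move=> fs; rewrite (sum_seqv _ fs) [RHS]big_mkcond; apply: eq_bigr => I _.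
by rewrite /extend; case: ifP; rewrite ?scale0r.
Qed.

Lemma extend_inc (D : nmodType) s (lam : seq nat -> D) I : face s ->
  extend s lam I != 0 -> inc I.
Proof. by case=> _ vs _; rewrite /extend; case: ifP => [/vs|]; rewrite ?eqxx. Qed.

Lemma extend_weight (D : zmodType) (pos : pred D) s (lam : seq nat -> D) :
  face s -> total_cone pos -> (forall I, I \in s -> pos (lam I)) -> weight pos (extend s lam).
Proof.
move=> fs posP h; split=> I; last exact: extend_inc.
by rewrite /extend; case: ifP => [/h|_] //; apply: cone0.
Qed.

Lemma extend_compatible (D : zmodType) s (lam : seq nat -> D) :
  face s -> compatible r (extend s lam).
Proof.
case=> _ vs cs I J; rewrite /extend.
case: ifP => [sI _|]; rewrite ?eqxx //; case: ifP => [sJ _|]; rewrite ?eqxx //.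
by have [] := proj1 (CP (vs _ sI) (vs _ sJ)) (cs _ _ sI sJ).
Qed.

Definition support (D : nmodType) (w : vec -> D) : seq (seq nat) :=
  map (@seqv k n) (enum [pred I : vec | w I != 0]).

Lemma mem_support (D : nmodType) (w : vec -> D) I : (seqv I \in support w) = (w I != 0).
Proof. by rewrite mem_map ?mem_enum //; apply: seqv_inj. Qed.

Lemma support_face (D : zmodType) (pos : pred D) (w : vec -> D) :
  weight pos w -> compatible r w -> face (support w).
Proof.
move=> [_ vw] cw; split=> [|I|I J].
- by rewrite map_inj_uniq ?enum_uniq //; apply: seqv_inj.
- by case/mapP => J; rewrite mem_enum => /vw vJ ->.
case/mapP => I'; rewrite mem_enum inE => wI ->.
case/mapP => J'; rewrite mem_enum inE => wJ ->.
by apply/CP; [exact: vw|exact: vw|split; apply: cw].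
Qed.

Lemma extend_unique (D : realDomainType) s t (lam mu : seq nat -> D) :
  face s -> face t -> (forall I, I \in s -> 0 <= lam I) -> (forall I, I \in t -> 0 <= mu I) ->
  \sum_(I <- s) lam I = \sum_(I <- t) mu I ->
  \sum_(I <- s) lam I *: chi D k n I = \sum_(I <- t) mu I *: chi D k n I ->
  extend s lam =1 extend t mu.
Proof.
move=> fs ft ps pt tot eqx.
have posP := nonneg_cone D.
apply: (compatible_unique rP posP); rewrite ?sum_extend //;
  try by [apply: extend_weight | apply: extend_compatible].
apply: chi_marginals => // [I|I||]; rewrite ?sum_extend ?sum_extend_chi //; exact: extend_inc.
Qed.

Lemma face_seqv s I : face s -> I \in s -> exists J : vec, I = seqv J.
Proof. by case=> _ vs _ /vs vI; exists (mkvec k n (nth 0%N I)); rewrite seqv_mkvec. Qed.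

(** The positive and negative parts of an affine dependence are two nonnegative combinations on the
    same face with equal total and equal point; uniqueness makes them coincide. *)
Lemma face_aff_indep (R : realFieldType) s : face s -> @aff_indep R k n s.
Proof.
move=> fs c c0 cx I sI.
have pI (a : R) : 0 <= Num.max a 0 by rewrite le_max lexx orbT.
have split_c (a : R) : Num.max a 0 = Num.max (- a) 0 + a.
  case: (leP 0 a) => h; case: leP => h'; rewrite ?addNr ?add0r //.
    by move: h'; rewrite oppr_gt0 => /(le_lt_trans h); rewrite ltxx.
  by move: h'; rewrite oppr_le0 => /(lt_le_trans h); rewrite ltxx.
have [J eI] := face_seqv fs sI.
have := @extend_unique R s s (fun I => Num.max (c I) 0) (fun I => Num.max (- c I) 0) fs fs
  (fun _ _ => pI _) (fun _ _ => pI _).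
rewrite /extend; have -> : \sum_(I <- s) Num.max (c I) 0 = \sum_(I <- s) Num.max (- c I) 0.
  by under eq_bigr do rewrite split_c; rewrite big_split /= c0 addr0.
have -> : \sum_(I <- s) Num.max (c I) 0 *: chi R k n I =
          \sum_(I <- s) Num.max (- c I) 0 *: chi R k n I.
  by under eq_bigr do rewrite split_c scalerDl; rewrite big_split /= cx addr0.
move=> /(_ erefl erefl J); rewrite -eI sI split_c => /eqP.
by rewrite -subr_eq0 addrC addKr => /eqP.
Qed.

(** By uniqueness the two representations of [x] agree after extension by zero, so the coefficients
    on [s] vanish outside [t]. *)
Lemma face_meet (R : realFieldType) s t (x : 'M[R]_(k, n - k)) : face s -> face t ->
  in_conv s x -> in_conv t x -> in_conv [seq I <- s | I \in t] x.
Proof.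
move=> fs ft [lam [pl sl xl]] [mu [pm sm xm]].
have off I : I \in s -> I \notin t -> lam I = 0.
  move=> sI /negPf tI; have [J eI] := face_seqv fs sI.
  have := extend_unique fs ft pl pm; rewrite sl sm -xl -xm => /(_ erefl erefl J).
  by rewrite /extend -eI sI tI.
exists lam; split=> [I||].
- by rewrite mem_filter => /andP[_ /pl].
- rewrite big_filter -sl big_mkcond; apply: eq_big_seq => I sI.
  by case: ifP => // /negbT /(off _ sI).
- rewrite big_filter xl [RHS]big_mkcond; apply: eq_big_seq => I sI.
  by case: ifP => // /negbT /(off _ sI) ->; rewrite scale0r.
Qed.

Lemma faces_cover (R : realFieldType) (x : 'M[R]_(k, n - k)) : in_order_polytope x ->
  exists s, face s /\ in_conv s x.
Proof.
case/(order_polytope_sum kn) => w [ww w1 wx].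
have [w' [ww' mar cw']] := exists_compatible rP (nonneg_cone R) ww.
pose lam I := w' (mkvec k n (nth 0%N I)).
have fs := support_face ww' cw'.
have ext : extend (support w') lam =1 w'.
  move=> I; rewrite /extend mem_support; case: eqVneq => //= nI.
  rewrite /lam; congr w'; apply: (@seqv_inj k n); rewrite seqv_mkvec //.
  by apply: (proj2 ww').
exists (support w'); split => //; exists lam; split=> [I _||].
- exact: (proj1 ww').
- by rewrite -sum_extend // (eq_bigr _ (fun I _ => ext I)) (marginals_total k1 mar).
- rewrite -sum_extend_chi // -wx -(marginals_chi mar).
  by apply: eq_bigr => I _; rewrite ext.
Qed.

(* Perturb the barycentre of [s] infinitesimally towards the vertex [chi J]: the leading
   coordinate of the compatible representation over [int * int] forces its support to be [s]
   by maximality, and the infinitesimal coordinate expresses [chi J] through [s]. *)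
Lemma maximal_span s (J : vec) : maximal_face face s -> inc J ->
  exists c : seq nat -> int, \sum_(I <- s) c I = 1 /\
    chi int k n (seqv J) = \sum_(I <- s) c I *: chi int k n I.
Proof.
move=> [fs maxs] vJ.
pose w (I : vec) : int * int := ((seqv I \in s)%:R, (I == J)%:R).
have ww : weight lex_ge0 w.
  split=> I; rewrite /w /lex_ge0 /=; first by case: (_ \in _); case: (I == J).
  case: (boolP (seqv I \in s)) => [sI _|_]; first by case: fs => _ vs _; apply: vs.
  by case: (eqVneq I J) => [->|_].
have [w' [ww' mar cw']] := exists_compatible rP lex_cone ww.
pose w1 I := (w' I).1; pose w2 I := (w' I).2.
have mar1 : same_marginals (fun I => (w I).1) w1.
  by move=> a p ak; rewrite -!fst_sum mar.
have mar2 : same_marginals (fun I => (w I).2) w2.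
  by move=> a p ak; rewrite -!snd_sum mar.
have w1_supp I : w1 I != 0 -> w' I != 0 by apply: contraNN => /eqP wI; rewrite /w1 wI.
have [wp' vw'] := ww'.
(* The leading coordinate is itself a compatible nonnegative weight with the marginals of the
   indicator of [s], so uniqueness over [int] identifies them. *)
have ew : extend s (fun _ => 1) =1 w1.
  apply: (compatible_unique rP (nonneg_cone int)).
  - by apply: extend_weight => //; apply: nonneg_cone.
  - split=> I; last by move/w1_supp/vw'.
    by have /orP[/ltW|/andP[/eqP + _]] := wp' I; rewrite /w1 // => ->.
  - exact: extend_compatible.
  - by move=> I K /w1_supp wI /w1_supp wK; apply: cw'.
  - rewrite -(marginals_total k1 mar1); apply: eq_bigr => I _.
    by rewrite /extend /w /=; case: ifP.
  - move=> a p ak; rewrite -mar1 //; apply: eq_bigr => I _.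
    by rewrite /extend /w /=; case: ifP.
have sub_s : {subset s <= support w'}.
  move=> I sI; have [K eI] := face_seqv fs sI; rewrite eI mem_support; apply: w1_supp.
  by rewrite -ew /extend -eI sI.
have sup_s := maxs _ (support_face ww' cw') sub_s.
pose c I := w2 (mkvec k n (nth 0%N I)).
have ec : extend s c =1 w2.
  move=> I; rewrite /extend; case: ifP => [sI|/negbT nI].
    rewrite /c; congr w2; apply: (@seqv_inj k n); rewrite seqv_mkvec //.
    by case: fs => _ vs _; apply: vs.
  have : w' I == 0 by rewrite -[_ == _]negbK -mem_support; apply: contra nI; apply: sup_s.
  by rewrite /w2 => /eqP ->.
have wJ : (fun I => (w I).2) =1 point_mass J 1.
  by move=> I; rewrite /w /point_mass /=; case: eqP.
exists c; split.
  rewrite -sum_extend // (eq_bigr _ (fun I _ => ec I)) -(marginals_total k1 mar2).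
  by rewrite (eq_bigr _ (fun I _ => wJ I)) sum_point_mass.
rewrite -sum_extend_chi //; under [RHS]eq_bigr do rewrite ec.
rewrite -(marginals_chi mar2); under [RHS]eq_bigr do rewrite wJ.
by apply/matrixP => i j; rewrite sum_chi_entry sum_point_mass chi_seqv; case: ifP.
Qed.

Theorem flag_triangulates (R : realFieldType) : triangulates R k n face.
Proof.
split; [exact: face_aff_indep | exact: faces_cover | move=> s t x; exact: face_meet].
Qed.

Theorem flag_unimodular : unimodular k n face.
Proof.
move=> s ms I0 sI0 z; have [fs _] := ms.
(* When the coefficients sum to 0 the base vertex cancels. Such combinations are closed under sums
   and integer multiples, so elementary matrices suffice, and each is a difference of two vertices
   covered by [maximal_span]. *)
suff [c [c0 cz]] : exists c : seq nat -> int, \sum_(I <- s) c I = 0 /\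
    z = \sum_(I <- s) c I *: chi int k n I.
  exists c; under eq_bigr do rewrite scalerBr.
  by rewrite sumrB -cz -scaler_suml c0 scale0r subr0.
rewrite (matrix_sum_delta z).
elim/big_ind: _ => [|x y [c [c0 ->]] [d [d0 ->]]|a _].
- by exists (fun _ => 0); split; rewrite big1 // => I _; rewrite scale0r.
- exists (fun I => c I + d I); split; first by rewrite big_split /= c0 d0 addr0.
  by under [RHS]eq_bigr do rewrite scalerDl; rewrite big_split.
elim/big_ind: _ => [|x y [c [c0 ->]] [d [d0 ->]]|b _].
- by exists (fun _ => 0); split; rewrite big1 // => I _; rewrite scale0r.
- exists (fun I => c I + d I); split; first by rewrite big_split /= c0 d0 addr0.
  by under [RHS]eq_bigr do rewrite scalerDl; rewrite big_split.
have [I [J [vI vJ ->]]] := delta_chi kn a b.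
have [c [c1 ->]] := maximal_span ms vI; have [d [d1 ->]] := maximal_span ms vJ.
exists (fun I => z a b * (c I - d I)); split.
  by rewrite -mulr_sumr sumrB c1 d1 subrr mulr0.
rewrite -sumrB scaler_sumr; apply: eq_bigr => K _.
by rewrite -scalerBl scalerA.
Qed.

End Triangulation.

Theorem theorem4p4 (R : realFieldType) (k n : nat) :
  (1 <= k)%N -> (k <= n - 1)%N ->
  (triangulates R k n (DeltaNN k n) /\ unimodular k n (DeltaNN k n)) /\
  (triangulates R k n (DeltaNC k n) /\ unimodular k n (DeltaNC k n)).
Proof.
move=> k1 kn1; have kn : (k <= n)%N by apply: leq_trans kn1 (leq_subr _ _).
split; split.
- exact: (flag_triangulates k1 kn (revlex_rank k n) (@nonnestingP k n)).
- exact: (flag_unimodular k1 kn (revlex_rank k n) (@nonnestingP k n)).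
- exact: (flag_triangulates k1 kn (corevlex_rank k n) (@noncrossingP k n)).
- exact: (flag_unimodular k1 kn (corevlex_rank k n) (@noncrossingP k n)).
Qed.
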